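(* There is a polynomial-time algorithm which maps every instance $(G,s,X)$ of Nemesis in which $G$ is a simple graph to an instance $(G',s',\{t_1,t_2\})$ of Nemesis in which $G'$ is a simple graph and there are exactly two exits $t_1,t_2$, such that the fugitive has a winning strategy in $(G,s,X)$ if and only if he has a winning strategy in $(G',s',\{t_1,t_2\})$.
   Context: Nemesis is a two-player game. An instance $(G,s,X)$ consists of a finite graph $G=(V,E)$, a set $X\subseteq V$ of vertices called exits, and a starting vertex $s\in V$ for the first player, the fugitive. In each round the fugitive first moves from his current vertex to an adjacent vertex along an edge still present; then the second player, the Nemesis, permanently removes exactly one edge chosen anywhere in the current graph. The fugitive wins if he reaches an exit; the Nemesis wins if the fugitive ends up in a connected component of the current graph containing no exit. *)

(* Defs.v *)
From mathcomp Require Import all_boot.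

Set Implicit Arguments.
Unset Strict Implicit.
Unset Printing Implicit Defensive.

(* Edges are vertex sets; in the instances below they all have two elements,
   so the set of the edges still present describes the current graph.  A
   history lists the completed rounds: the vertex the fugitive moved to and
   the edge then removed. *)

Section Game.

Variables (V : finType) (E : {set {set V}}) (s : V) (X : {set V}).

Definition adjacent (F : {set {set V}}) : rel V :=
  fun u v => [set u; v] \in F.

Definition history := seq (V * {set V}).

Definition position (h : history) : V := last s (unzip1 h).

Definition remaining (h : history) : {set {set V}} :=
  E :\: [set e | e \in unzip2 h].

Definition trapped (h : history) : bool :=
  [forall x in X, ~~ connect (adjacent (remaining h)) (position h) x].

Definition fugitive_strategy := history -> V.

(* The second argument is the vertex the fugitive has just moved to. *)
Definition nemesis_strategy := history -> V -> {set V}.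

(* The Nemesis may not pass. After a legal move of the fugitive an edge is
   always left to remove. *)
Definition legal_nemesis (tau : nemesis_strategy) : Prop :=
  forall h v, remaining h != set0 -> tau h v \in remaining h.

Fixpoint play (sigma : fugitive_strategy) (tau : nemesis_strategy) (n : nat)
    : history :=
  if n is m.+1 then
    let h := play sigma tau m in rcons h (sigma h, tau h (sigma h))
  else [::].

(* The fugitive stands on an exit after n moves, the first n moves being legal
   and the Nemesis not having won before. The exit is reached before the
   Nemesis answers the n-th move; her answer does not affect the position. *)
Definition fugitive_wins_play (sigma : fugitive_strategy)
    (tau : nemesis_strategy) : Prop :=
  exists n,
    position (play sigma tau n) \in X /\
    forall i, i < n ->
      let h := play sigma tau i in
      ~~ trapped h /\ adjacent (remaining h) (position h) (sigma h).

Definition winning_strategy (sigma : fugitive_strategy) : Prop :=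
  forall tau, legal_nemesis tau -> fugitive_wins_play sigma tau.

End Game.

Record instance := Instance {
  num_vertices : nat;
  edges : {set {set 'I_num_vertices}};
  start : 'I_num_vertices;
  exits : {set 'I_num_vertices};
  edges_simple : [forall e in edges, #|e| == 2]
}.

Definition fugitive_has_winning_strategy (I : instance) : Prop :=
  exists sigma, winning_strategy (edges I) (start I) (exits I) sigma.

(* 1^n 0, the indicator vectors of the start vertex and of the exits, and the
   adjacency matrix in row-major order. *)
Definition encode (I : instance) : seq bool :=
  let vs := enum 'I_(num_vertices I) in
  nseq (num_vertices I) true ++ false ::
  [seq i == start I | i <- vs] ++
  [seq i \in exits I | i <- vs] ++
  [seq adjacent (edges I) i j | i <- vs, j <- vs].

Lemma encode_inj : injective encode.
Proof.
have prefix_inj n m (u v : seq bool) :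
    nseq n true ++ false :: u = nseq m true ++ false :: v -> n = m /\ u = v.
  elim: n m => [|n IHn] [|m] //=; first by case.
  by case=> /IHn [-> ->].
have sub_edges n (A B : {set {set 'I_n}}) :
    [forall e in A, #|e| == 2] -> adjacent A =2 adjacent B -> A \subset B.
  move=> simpleA eqAB; apply/subsetP=> e eA.
  have /cards2P [x [y [_ def_e]]] := implyP (forallP simpleA e) eA.
  by move: eA; rewrite def_e -[_ \in A]/(adjacent A x y) eqAB.
move=> [n E s X hE] [m F t Y hF]; rewrite /encode /=.
case/prefix_inj=> eq_nm; subst m => /eqP.
rewrite !eqseq_cat ?size_map // => /and3P [/eqP eq_s /eqP eq_X /eqP eq_E].
have {eq_s} /eqP est : s == t.
  by have /(_ s) := (eq_in_map _ _ _).2 eq_s; rewrite mem_enum eqxx => <-.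
have {eq_X} eXY : X = Y.
  apply/setP=> i.
  by have /(_ i) := (eq_in_map _ _ _).2 eq_X; rewrite mem_enum => ->.
have {eq_E} eqEF : adjacent E =2 adjacent F.
  by move=> i j; apply: (eq_in_allpairs _ _ _ _).2 eq_E _ _ _ _;
     rewrite mem_enum.
have eEF : E = F.
  by apply/eqP; rewrite eqEsubset !sub_edges.
by move: hE hF; rewrite est eXY eEF => h1 h2; rewrite (bool_irrelevance h1 h2).
Qed.

(* Random access machines with the instruction set of Cook and Reckhow (Time
   bounded random access machines, JCSS 1973), over natural numbers. Since
   there is no multiplication, unit-cost running time is polynomially related
   to Turing machine time. *)

Inductive instr :=
  | Const of nat & nat          (* R[i] := c *)
  | Add of nat & nat & nat      (* R[i] := R[j] + R[k] *)
  | Sub of nat & nat & nat      (* R[i] := R[j] - R[k], truncated *)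
  | Fetch of nat & nat           (* R[i] := R[R[j]] *)
  | Store of nat & nat          (* R[R[i]] := R[j] *)
  | Jpos of nat & nat           (* if R[j] > 0 goto m, arguments j m *)
  | Read of nat                 (* R[i] := next input bit, 2 at the end *)
  | Print of nat.               (* output the bit R[i] > 0 *)

Record config := Config {
  pc : nat;
  mem : nat -> nat;
  inp : seq bool;
  out : seq bool
}.

Definition upd (m : nat -> nat) (i x : nat) : nat -> nat :=
  fun j => if j == i then x else m j.

Definition read_val (w : seq bool) : nat :=
  if w is b :: _ then nat_of_bool b else 2.

Definition exec (a : instr) (c : config) : config :=
  let: Config l m w o := c in
  match a with
  | Const i x => Config l.+1 (upd m i x) w o
  | Add i j k => Config l.+1 (upd m i (m j + m k)) w o
  | Sub i j k => Config l.+1 (upd m i (m j - m k)) w o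
  | Fetch i j => Config l.+1 (upd m i (m (m j))) w o
  | Store i j => Config l.+1 (upd m (m i) (m j)) w o
  | Jpos j l' => Config (if 0 < m j then l' else l.+1) m w o
  | Read i => Config l.+1 (upd m i (read_val w)) (behead w) o
  | Print i => Config l.+1 m w (rcons o (0 < m i))
  end.

(* The machine halts when the program counter leaves the program; halted
   configurations are fixed points. *)
Definition step (P : seq instr) (c : config) : config :=
  if onth P (pc c) is Some a then exec a c else c.

Definition init (w : seq bool) : config := Config 0 (fun _ => 0) w [::].

Definition outputs_within (P : seq instr) (t : nat) (w v : seq bool) : Prop :=
  let c := iter t (step P) (init w) in size P <= pc c /\ out c = v.

Definition polytime (A B : Type) (encA : A -> seq bool) (encB : B -> seq bool)
    (f : A -> B) : Prop :=
  exists (P : seq instr) (c k : nat), forall a : A,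
    outputs_within P (c * size (encA a) ^ k + c) (encA a) (encB (f a)).

(* Main.v *)
Require Import Defs.
From mathcomp Require Import all_boot zify.

(** Every edge {v, x} from a vertex v to an exit x is replaced by a new vertex
    w joined to v, t1 and t2.  Moving to w wins as long as both edges from w to
    the exits are present, since the Nemesis can remove only one of them; once
    one of the three edges at w is gone, w is useless, since the Nemesis answers
    a move to w by removing the last edge from w to an exit and the fugitive has
    to return to v with fewer edges left.  Hence removing any of the three edges
    at w amounts to removing {v, x}.  The remaining edges between non-exits are
    kept, and an old exit is joined to t1 and t2, which matters only if the
    fugitive starts there.

    For the running time, the reduction is written in a small structured
    language over the machine, with the new vertices arranged in an
    (n+1) x (n+1) grid, so that the output is printed by nested loops without
    multiplication or division. *)

Set Implicit Arguments.
Unset Strict Implicit.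
Unset Printing Implicit Defensive.

Lemma eq_set2 (T : finType) (a b c d : T) :
  [set a; b] = [set c; d] -> (a = c /\ b = d) \/ (a = d /\ b = c).
Proof.
move=> eq_ab.
have := set21 a b; have := set22 a b; rewrite eq_ab !inE.
have := set21 c d; have := set22 c d; rewrite -eq_ab !inE.
by do 4![case/orP=> /eqP ?]; subst; auto.
Qed.

(** * Determinacy: winning positions by recursion on the graph *)

Section Winning.

Variables (V : finType) (X : {set V}).
Implicit Types (F : {set {set V}}) (u v : V).

(** Fuel [k] counts rounds. As every round removes an edge, [#|F|] rounds suffice. Trapping is not
    mentioned here: [wins_connect] shows that it cannot occur at a winning position. *)
Fixpoint wins_in k F v : bool :=
  (v \in X) ||
  if k is k'.+1 then
    [exists u, adjacent F v u && [forall e in F, wins_in k' (F :\ e) u]]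
  else false.

Definition wins F v := wins_in #|F| F v.

Lemma winsE F v :
  wins F v = (v \in X) ||
    [exists u, adjacent F v u && [forall e in F, wins (F :\ e) u]].
Proof.
rewrite /wins; case def_k: #|F| => [|k] /=; congr (_ || _).
  apply/esym/existsP=> -[u /andP[vu _]].
  by move/cards0_eq: def_k vu => ->; rewrite /adjacent inE.
apply: eq_existsb => u; congr (_ && _); apply: eq_forallb_in => e eF.
by move: def_k; rewrite (cardsD1 e) eF add1n => -[->].
Qed.

Lemma wins_exit F v : v \in X -> wins F v.
Proof. by rewrite winsE => ->. Qed.

Lemma wins_move F v u :
  adjacent F v u -> (forall e, e \in F -> wins (F :\ e) u) -> wins F v.
Proof.
move=> vu Hu; rewrite winsE; apply/orP; right; apply/existsP; exists u.
by rewrite vu; apply/forall_inP.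
Qed.

Lemma wins_inv F v : wins F v -> v \notin X ->
  exists2 u, adjacent F v u & forall e, e \in F -> wins (F :\ e) u.
Proof.
rewrite winsE => /orP[-> //|/existsP[u /andP[vu /forall_inP Hu]]] _.
by exists u.
Qed.

(** Let the Nemesis remove the very edge that the fugitive has just used: he still wins, so by
    induction an exit is reachable from his new vertex. *)
Lemma wins_connect F v :
  wins F v -> exists2 x, x \in X & connect (adjacent F) v x.
Proof.
have [k le_k] := ubnP #|F|; elim: k F v le_k => // k IHk F v le_k.
case: (boolP (v \in X)) => [vX _|vX /wins_inv /(_ vX) [u vu Hu]].
  by exists v => //; apply: connect0.
have [|x xX ux] := IHk _ _ _ (Hu _ vu).
  by move: le_k; rewrite (cardsD1 [set v; u]) [_ \in F]vu add1n ltnS.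
exists x => //; apply: connect_trans (connect1 vu) _.
by apply: connect_sub ux => a b; rewrite /adjacent inE => /andP[_ ?]; apply: connect1.
Qed.

Variables (E : {set {set V}}) (s : V).

Lemma position_rcons (h : history V) v e : position s (rcons h (v, e)) = v.
Proof. by rewrite /position /unzip1 map_rcons last_rcons. Qed.

Lemma remaining_rcons (h : history V) v e :
  remaining E (rcons h (v, e)) = remaining E h :\ e.
Proof.
by apply/setP=> x; rewrite !inE /unzip2 map_rcons mem_rcons inE negb_or andbA.
Qed.

Definition greedy_fugitive : fugitive_strategy V := fun h =>
  odflt s [pick u | adjacent (remaining E h) (position s h) u &
            [forall e in remaining E h, wins (remaining E h :\ e) u]].

(** The fallback to an arbitrary remaining edge keeps the strategy legal where no removal makes the
    fugitive lose. *)
Definition greedy_nemesis : nemesis_strategy V := fun h v =>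
  if [pick e in remaining E h | ~~ wins (remaining E h :\ e) v] is Some e then e
  else odflt set0 [pick e in remaining E h].

Lemma greedy_nemesis_legal : legal_nemesis E greedy_nemesis.
Proof.
move=> h v /set0Pn[e0 e0h]; rewrite /greedy_nemesis.
case: pickP => [e /andP[] //|_].
by case: pickP => [//|/(_ e0)]; rewrite e0h.
Qed.

Lemma greedy_fugitive_wins : wins E s -> winning_strategy E s X greedy_fugitive.
Proof.
move=> Ws tau tau_legal; rewrite /fugitive_wins_play.
set h_ := play _ _.
(* Generalized to the play from round [i] on, by induction on the number of remaining edges. *)
suff: forall k i, #|remaining E (h_ i)| < k ->
    wins (remaining E (h_ i)) (position s (h_ i)) ->
    exists n, position s (h_ n) \in X /\ forall j, i <= j < n ->
      ~~ trapped E s X (h_ j) /\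
      adjacent (remaining E (h_ j)) (position s (h_ j)) (greedy_fugitive (h_ j)).
  move=> /(_ _ 0 (ltnSn _)) /=.
  have -> : remaining E [::] = E.
    by apply/setP=> e; rewrite !inE.
  by case/(_ Ws) => n [nX Hn]; exists n; split=> // i ltin; apply: Hn.
elim=> // k IHk i le_k Wi.
have [iX|iNX] := boolP (position s (h_ i) \in X).
  by exists i; split=> // j; lia.
have [u0 u0i Hu0] := wins_inv Wi iNX.
set u := greedy_fugitive (h_ i).
have [ui Hu] : adjacent (remaining E (h_ i)) (position s (h_ i)) u /\
    forall e, e \in remaining E (h_ i) -> wins (remaining E (h_ i) :\ e) u.
  rewrite /u /greedy_fugitive; case: pickP => [v /andP[vi /forall_inP //]|/(_ u0)].
  by rewrite u0i => /forall_inP[].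
(* The edge just traversed is still present, so legality forces a genuine removal. *)
have tau_i : tau (h_ i) u \in remaining E (h_ i).
  by apply: tau_legal; apply/set0Pn; exists [set position s (h_ i); u].
have remS : remaining E (h_ i.+1) = remaining E (h_ i) :\ tau (h_ i) u.
  by rewrite /= remaining_rcons.
have posS : position s (h_ i.+1) = u by rewrite /= position_rcons.
have [||n [nX Hn]] := IHk i.+1.
- by rewrite remS; move: le_k; rewrite (cardsD1 (tau (h_ i) u)) tau_i add1n ltnS.
- by rewrite remS posS; apply: Hu.
exists n; split=> // j /andP[]; rewrite leq_eqVlt => /orP[/eqP<- _|ltij ltjn].
  split=> //; apply/negP=> /forall_inP nc.
  by have [x xX] := wins_connect Wi; apply/negP/nc.
by apply: Hn; rewrite ltij.
Qed.

(** The greedy fugitive stays in winning positions. From a losing position the greedy Nemesis keeps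
    every later position losing, and an exit is never losing, so no strategy beats her. *)
Lemma winning_strategyP : (exists sigma, winning_strategy E s X sigma) <-> wins E s.
Proof.
split=> [[sigma win_sigma]|]; last by exists greedy_fugitive; apply: greedy_fugitive_wins.
have [n [nX Hn]] := win_sigma _ greedy_nemesis_legal.
apply: contraLR nX => lose; move: Hn.
have: ~~ wins (remaining E [::]) (position s [::]).
  by have -> : remaining E [::] = E by apply/setP=> e; rewrite !inE.
set h_ := play _ _; rewrite -/(h_ 0) => lose0 Hn.
suff /(_ n (leqnn n)) : forall i, i <= n ->
    ~~ wins (remaining E (h_ i)) (position s (h_ i)).
  by apply: contra => /wins_exit.
elim=> // i IHi ltin; have /= := IHi (ltnW ltin); have [_ adj_i] := Hn i ltin.
rewrite /= remaining_rcons position_rcons; set e := greedy_nemesis _ _; apply: contra.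
rewrite {}/e /greedy_nemesis; case: pickP => [e /andP[_ /negP] //|noe _].
apply: (wins_move adj_i) => e eh.
by have := noe e; rewrite eh /= => /negbFE.
Qed.

End Winning.

(** * Correctness of the gadget replacement for abstract graphs *)

Section Reduction.

Variables (V V' : finType) (E : {set {set V}}) (X : {set V}).
Variables (E' : {set {set V'}}) (o : V -> V') (g : V -> V -> V') (t1 t2 : V').

(* The edges of the new graph that stand for the edge {u, w} of the old one,
   where u is not an exit. *)
Definition gadget (u w : V) : {set {set V'}} :=
  if w \in X then
    [set [set o u; g u w]; [set g u w; t1]; [set g u w; t2]]
  else [set [set o u; o w]].

(* The union of the labels of the two ends of an edge in gadget u w is {u, w},
   so edges of the new graph determine the edge that they stand for. *)
Variable label : V' -> {set V}.
Hypotheses (label_o : forall u, label (o u) = [set u])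
  (label_g : forall u w, label (g u w) = [set u; w])
  (label_t1 : label t1 = set0) (label_t2 : label t2 = set0) (t12 : t1 != t2).

Hypothesis adj_o : forall u q, u \notin X -> adjacent E' (o u) q ->
  (exists2 w, w \notin X & q = o w) \/ (exists2 x, x \in X & q = g u x).
Hypothesis adj_g : forall u x q, u \notin X -> x \in X ->
  adjacent E' (g u x) q -> [\/ q = o u, q = t1 | q = t2].
Hypothesis gadgetE : forall u w, u \notin X ->
  (gadget u w \subset E') = ([set u; w] \in E).
Hypothesis exit_t1 : forall x, x \in X -> adjacent E' (o x) t1.

Let X' := [set t1; t2].

Lemma label_gadget u w e' : e' \in gadget u w ->
  \bigcup_(p in e') label p = [set u; w].
Proof.
have bigU2 p q : \bigcup_(r in [set p; q]) label r = label p :|: label q.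
  apply/setP=> a; apply/bigcupP/setUP => [[r]|[]].
  - by rewrite !inE => /orP[] /eqP->; auto.
  - by exists p; rewrite ?set21.
  - by exists q; rewrite ?set22.
rewrite /gadget; case: ifP => _; last first.
  by move/set1P->; rewrite bigU2 !label_o.
rewrite !inE => /orP[/orP[]|] /eqP->;
  rewrite bigU2 ?label_t1 ?label_t2 label_g ?setU0 //.
by rewrite label_o setUA setUid.
Qed.

Lemma gadget_inj u w u2 w2 e' :
  e' \in gadget u w -> e' \in gadget u2 w2 -> [set u; w] = [set u2; w2].
Proof. by move=> /label_gadget <- /label_gadget <-. Qed.

Lemma o_nexit u : o u \notin X'.
Proof.
rewrite !inE; apply/norP; split; apply/eqP=> /(congr1 label) /setP /(_ u).
  by rewrite label_o label_t1 !inE eqxx.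
by rewrite label_o label_t2 !inE eqxx.
Qed.

Lemma g_nexit u w : g u w \notin X'.
Proof.
rewrite !inE; apply/norP; split; apply/eqP=> /(congr1 label) /setP /(_ u).
  by rewrite label_g label_t1 !inE eqxx.
by rewrite label_g label_t2 !inE eqxx.
Qed.

(** Invariant for carrying a win of the fugitive to the new graph: every live old edge has an intact
    gadget. *)
Definition simulates (F : {set {set V}}) (F' : {set {set V'}}) :=
  forall u w, u \notin X -> [set u; w] \in F -> gadget u w \subset F'.

(** By [gadget_inj] a new edge belongs to the gadget of at most one old edge, which is given up with
    it. If there is none, [e0] is removed instead, since the Nemesis may not pass. *)
Lemma simulates_remove (F : {set {set V}}) (F' : {set {set V'}}) e0 e' :
  e0 \in F -> simulates F F' ->
  exists2 e, e \in F & simulates (F :\ e) (F' :\ e').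
Proof.
move=> e0F sim.
have [/existsP[u /existsP[w /and3P[uX uwF e'uw]]]|no] := boolP [exists u, exists w,
  [&& u \notin X, [set u; w] \in F & e' \in gadget u w]].
  exists [set u; w] => // u2 w2 u2X; rewrite !inE => /andP[ne uw2F].
  apply/subsetD1P; split; first exact: sim.
  by apply: contra ne => /gadget_inj /(_ e'uw) ->.
exists e0 => // u w uX; rewrite !inE => /andP[_ uwF].
apply/subsetD1P; split; first exact: sim.
apply: contra no => e'uw; apply/existsP; exists u; apply/existsP; exists w.
by rewrite uX uwF.
Qed.

Lemma wins_simulates (F : {set {set V}}) (F' : {set {set V'}}) v :
  simulates F F' -> v \notin X -> wins X F v -> wins X' F' (o v).
Proof.
have [k le_k] := ubnP #|F|; elim: k F F' v le_k => // k IHk F F' v le_k sim vX.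
case/wins_inv=> // u vu Hu; have := sim v u vX vu; rewrite /gadget.
have [uX|uX] := boolP (u \in X); last first.
  rewrite sub1set => ou; apply: (wins_move (u := o u)) => // e' e'F'.
  have [e eF sim'] := simulates_remove e' vu sim.
  apply: IHk sim' uX (Hu e eF).
  by move: le_k; rewrite (cardsD1 e) eF add1n ltnS.
move=> /subsetP sub; apply: (wins_move (u := g v u)) => [|e' _].
  by apply: sub; rewrite !inE eqxx.
(* The Nemesis has removed only one edge since the move into the gadget, so [t2] or [t1] can still
   be reached from its middle vertex. *)
have [def_e'|ne] := eqVneq e' [set g v u; t1].
  apply: (wins_move (u := t2)) => [|e _]; last by rewrite wins_exit // set22.
  rewrite /adjacent !inE sub ?inE ?eqxx ?orbT ?andbT // def_e'.
  apply/eqP=> /eq_set2[[_ /esym/eqP]|[/eqP]]; first by rewrite (negPf t12).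
  by have := g_nexit v u; rewrite !inE => /norP[/negPf->].
apply: (wins_move (u := t1)) => [|e _]; last by rewrite wins_exit // set21.
by rewrite /adjacent !inE sub ?inE ?eqxx ?orbT ?andbT // eq_sym.
Qed.

(** Invariant for the converse: an old edge may disappear only if its gadget is broken. The
    inclusion in [E'] makes [adj_o] and [adj_g] apply to the fugitive's moves. *)
Definition simulated (F : {set {set V}}) (F' : {set {set V'}}) :=
  F' \subset E' /\
  forall u w, u \notin X -> gadget u w \subset F' -> [set u; w] \in F.

Lemma simulatedS F (F1 F2 : {set {set V'}}) :
  F2 \subset F1 -> simulated F F1 -> simulated F F2.
Proof.
move=> sub [sE sim]; split=> [|u w uX uw]; first exact: subset_trans sE.
by apply: sim => //; apply: subset_trans sub.
Qed.

(** If one end is an exit, it must be the second argument on both sides; between non-exits the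
    gadget is a single unordered edge. *)
Lemma gadget_sym u w u2 w2 : u \notin X -> u2 \notin X ->
  [set u; w] = [set u2; w2] -> gadget u w = gadget u2 w2.
Proof.
move=> uX u2X /eq_set2[[-> -> //]|[eu ew]]; subst.
by rewrite /gadget (negPf uX) (negPf u2X) setUC.
Qed.

(** One edge of an intact gadget of [e] is enough to break it. If no gadget of [e] is intact, any
    edge [e0] serves as the compulsory removal. *)
Lemma simulated_remove (F : {set {set V}}) (F' : {set {set V'}}) e e0 :
  e0 \in F' -> simulated F F' ->
  exists2 e', e' \in F' & simulated (F :\ e) (F' :\ e').
Proof.
move=> e0F' [sE sim].
have [/existsP[u /existsP[w /and3P[uX /eqP def_e uwF']]]|no] :=
  boolP [exists u, exists w, [&& u \notin X, [set u; w] == e & gadget u w \subset F']].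
  have [e' e'uw] : exists e', e' \in gadget u w.
    exists [set o u; if w \in X then g u w else o w].
    by rewrite /gadget; case: ifP => _; rewrite !inE eqxx.
  exists e'; first exact: (subsetP uwF').
  split=> [|u2 w2 u2X /subsetD1P[sub2 e'2]].
    by apply: subset_trans sE; apply: subD1set.
  rewrite !inE sim // andbT; apply: contra e'2 => /eqP def_e2.
  by rewrite (gadget_sym (w2 := w) u2X uX) // def_e2 def_e.
exists e0 => //; split=> [|u w uX /subsetD1P[sub _]].
  by apply: subset_trans sE; apply: subD1set.
rewrite !inE sim // andbT; apply: contra no => /eqP def_e.
by apply/existsP; exists u; apply/existsP; exists w; rewrite uX def_e eqxx.
Qed.

(* A gadget that has lost an edge at an exit is useless: the Nemesis answers a
   move into it by removing the other edge, and the fugitive can only go back. *)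
Lemma wins_simulated (F : {set {set V}}) (F' : {set {set V'}}) v :
  simulated F F' -> v \notin X -> wins X' F' (o v) -> wins X F v.
Proof.
have [k le_k] := ubnP #|F'|; elim: k F F' v le_k => // k IHk F F' v le_k simF vX.
have [sE sim] := simF.
case/wins_inv=> [|q vq Hq]; first exact: o_nexit.
have [[w wX def_q]|[x xX def_q]] := adj_o vX (subsetP sE _ vq); subst q.
  have vw : [set v; w] \in F by apply: sim; rewrite // /gadget (negPf wX) sub1set.
  apply: (wins_move vw) => e eF.
  have [e' e'F' sim'] := simulated_remove e vq simF.
  apply: IHk sim' wX (Hq e' e'F').
  by move: le_k; rewrite (cardsD1 e') e'F' add1n ltnS.
have [/(sim _ _ vX) vx|broken] := boolP (gadget v x \subset F').
  by apply: (wins_move vx) => e _; apply: wins_exit.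
(* The edge from [o v] has just been used, so the missing edge is one to an exit. The Nemesis
   removes the other one or, if both are gone, the edge just used. *)
have [e' e'F' /andP[t1F' t2F']] : exists2 e', e' \in F' &
    ([set g v x; t1] \notin F' :\ e') && ([set g v x; t2] \notin F' :\ e').
  move: broken; rewrite /gadget xX !subUset !sub1set [_ \in F']vq /= negb_and.
  have [t1F' /= t2F'|t1F' _] := boolP ([set g v x; t1] \in F').
    by exists [set g v x; t1] => //; rewrite !inE eqxx (negPf t2F') andbF.
  have [t2F'|t2F'] := boolP ([set g v x; t2] \in F').
    by exists [set g v x; t2] => //; rewrite !inE eqxx (negPf t1F') andbF.
  by exists [set o v; g v x] => //; rewrite !inE (negPf t1F') (negPf t2F') !andbF.
have sub' : F' :\ e' \subset F' by apply: subD1set.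
have [|q gq Hq'] := wins_inv (Hq e' e'F'); first exact: g_nexit.
have def_q : q = o v.
  have := subsetP (subset_trans sub' sE) _ gq.
  case/(adj_g vX xX) => // def_q; move: gq; rewrite def_q /adjacent.
    by rewrite (negPf t1F').
  by rewrite (negPf t2F').
(* After the return the Nemesis removes the edge [gq]. The old graph is still [F] while the new one
   has shrunk, hence the induction on [#|F'|]. *)
rewrite def_q in gq Hq'; move/Hq': (gq); apply: IHk => //.
  apply: leq_ltn_trans (subset_leq_card (subD1set _ _)) _.
  by move: le_k; rewrite (cardsD1 e') e'F' add1n ltnS.
by apply: simulatedS simF; apply: subset_trans (subD1set _ _) sub'.
Qed.

Lemma wins_reduction s : wins X E s <-> wins X' E' (o s).
Proof.
have [sX|sX] := boolP (s \in X).
  split=> _; last exact: wins_exit.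
  by apply: (wins_move (exit_t1 sX)) => e _; rewrite wins_exit // set21.
split; [apply: wins_simulates | apply: wins_simulated] => //.
  by move=> u w uX; rewrite gadgetE.
by split=> // u w uX; rewrite gadgetE.
Qed.

End Reduction.

(* Vertex (a, b) with a, b <= n is numbered a * n.+1 + b.  The pair (v, n) is
   the old vertex v, (v, x) is the middle vertex of the gadget for {v, x}, the
   exits are (n, 0) and (n, n), and the other pairs are isolated.  If {v, x} is
   not an edge to an exit, then (v, x) is adjacent to the exits only. *)
Definition grid_size (n : nat) : nat := n.+1 * n.+1.

(** The disjuncts are the kept edges, the edges into middle vertices, and the edges to the exits.
    Plain numbers are used so that the program can evaluate the same formula on the input bits. *)
Definition arrow (n : nat) (ex : pred nat) (ad : rel nat) (a b c d : nat) : bool :=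
  [|| [&& b == n, d == n, a < n, c < n, ad a c, ~~ ex a & ~~ ex c],
      [&& b == n, d < n, a == c, a < n, ad a d & ex d]
    | [&& c == n, (d == 0) || (d == n), a < n & (b < n) || ex a]].

Definition linked n ex ad a b c d : bool :=
  arrow n ex ad a b c d || arrow n ex ad c d a b.

Lemma linkedC n ex ad a b c d : linked n ex ad a b c d = linked n ex ad c d a b.
Proof. exact: orbC. Qed.

(** Every lookup is guarded by bounds, so the input array, meaningful only below [n], can stand in
    for the graph. *)
Lemma eq_arrow n ex1 ex2 ad1 ad2 a b c d :
    (forall i, i < n -> ex1 i = ex2 i) ->
    (forall i j, i < n -> j < n -> ad1 i j = ad2 i j) ->
  arrow n ex1 ad1 a b c d = arrow n ex2 ad2 a b c d.
Proof.
move=> eq_ex eq_ad; rewrite /arrow; congr [|| _, _ | _].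
- do 2!congr (_ && _); have [an|//] := ltnP a n; have [cn|//] := ltnP c n.
  by rewrite /= eq_ad // !eq_ex.
- congr (_ && _); have [dn|//] := ltnP d n; rewrite /=; congr (_ && _).
  by have [an|//] := ltnP a n; rewrite /= eq_ad // eq_ex.
- by do 2!congr (_ && _); have [an|//] := ltnP a n; rewrite eq_ex.
Qed.

Lemma eq_linked n ex1 ex2 ad1 ad2 a b c d :
    (forall i, i < n -> ex1 i = ex2 i) ->
    (forall i j, i < n -> j < n -> ad1 i j = ad2 i j) ->
  linked n ex1 ad1 a b c d = linked n ex2 ad2 a b c d.
Proof. by move=> eq_ex eq_ad; rewrite /linked !(eq_arrow _ _ _ _ eq_ex eq_ad). Qed.

Lemma grid_pointP n (a b : 'I_n.+1) : a * n.+1 + b < grid_size n.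
Proof. by rewrite /grid_size; have := ltn_ord a; have := ltn_ord b; nia. Qed.

(** * The grid graph as a concrete instance of the replacement *)

Section GridInstance.

Variables (n : nat) (E : {set {set 'I_n}}) (X : {set 'I_n}).
Hypothesis simpleE : [forall e in E, #|e| == 2].

Definition nat_exit (i : nat) : bool := [exists v in X, v == i :> nat].
Definition nat_adj (i j : nat) : bool :=
  [exists u : 'I_n, [exists v : 'I_n, [&& u == i :> nat, v == j :> nat & adjacent E u v]]].

Lemma nat_exitE (v : 'I_n) : nat_exit v = (v \in X).
Proof.
apply/existsP/idP => [[u /andP[uX /eqP /val_inj <-]] //|vX].
by exists v; rewrite vX eqxx.
Qed.

Lemma nat_adjE (u v : 'I_n) : nat_adj u v = adjacent E u v.
Proof.
apply/existsP/idP => [[i /existsP[j /and3P[/eqP/val_inj-> /eqP/val_inj->]]] //|uv].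
by exists u; apply/existsP; exists v; rewrite !eqxx.
Qed.

Lemma adjacent_irrefl u : adjacent E u u = false.
Proof.
apply/negP=> uu; have := implyP (forallP simpleE [set u; u]) uu.
by rewrite setUid cards1.
Qed.

Definition grid_adj (i j : 'I_(grid_size n)) : bool :=
  linked n nat_exit nat_adj (i %/ n.+1) (i %% n.+1) (j %/ n.+1) (j %% n.+1).

Lemma grid_adj_irrefl i : grid_adj i i = false.
Proof.
rewrite /grid_adj /linked orbb /arrow; set a := _ %/ _; set b := _ %% _.
case: ltnP => [an|]; last by rewrite !andbF.
rewrite /= (_ : nat_adj a a = nat_adj (Ordinal an) (Ordinal an)) // nat_adjE.
rewrite adjacent_irrefl !andbF /=.
case: eqVneq => [->|_]; rewrite /= ?ltnn ?andbF //=;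
  by move: an; rewrite ltn_neqAle => /andP[/negPf->].
Qed.

Definition grid_edges : {set {set 'I_(grid_size n)}} :=
  [set e | [exists i, exists j, (e == [set i; j]) && grid_adj i j]].

Lemma adjacent_grid i j : adjacent grid_edges i j = grid_adj i j.
Proof.
rewrite /adjacent inE; apply/existsP/idP => [[a /existsP[b /andP[/eqP]]]|ij].
  by case/eq_set2=> [[-> ->] //|[-> ->]]; rewrite /grid_adj linkedC.
by exists i; apply/existsP; exists j; rewrite eqxx.
Qed.

Lemma grid_edges_simple : [forall e in grid_edges, #|e| == 2].
Proof.
apply/forall_inP=> e; rewrite inE => /existsP[i /existsP[j /andP[/eqP-> ij]]].
rewrite cards2; case: (eqVneq i j) => // eq_ij; move: ij.
by rewrite eq_ij grid_adj_irrefl.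
Qed.

Definition grid_point (a b : 'I_n.+1) : 'I_(grid_size n) := Ordinal (grid_pointP a b).

Lemma grid_point_div a b : grid_point a b %/ n.+1 = a.
Proof. by rewrite /= divnMDl // divn_small // addn0. Qed.

Lemma grid_point_mod a b : grid_point a b %% n.+1 = b.
Proof. by rewrite /= modnMDl modn_small. Qed.

Lemma grid_pointK (i : 'I_(grid_size n)) :
  exists a b : 'I_n.+1, i = grid_point a b.
Proof.
have lt_a : i %/ n.+1 < n.+1 by rewrite ltn_divLR.
have lt_b : i %% n.+1 < n.+1 by rewrite ltn_mod.
exists (Ordinal lt_a), (Ordinal lt_b); apply: val_inj => /=; exact: divn_eq.
Qed.

Definition old_vertex (v : 'I_n) : 'I_(grid_size n) :=
  grid_point (lift ord_max v) ord_max.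
Definition mid_vertex (v x : 'I_n) : 'I_(grid_size n) :=
  grid_point (lift ord_max v) (lift ord_max x).
Definition exit1 : 'I_(grid_size n) := grid_point ord_max ord0.
Definition exit2 : 'I_(grid_size n) := grid_point ord_max ord_max.

(** Row [n], which contains both exits, has empty labels; column [n] adds nothing, so the pair
    [(v, n)] is labelled by [v] alone. *)
Definition grid_label (i : 'I_(grid_size n)) : {set 'I_n} :=
  [set v : 'I_n | (i %/ n.+1 < n) &&
    ((v == i %/ n.+1 :> nat) || (v == i %% n.+1 :> nat))].

Lemma adjacent_grid_point (a b c d : 'I_n.+1) :
  adjacent grid_edges (grid_point a b) (grid_point c d) =
  linked n nat_exit nat_adj a b c d.
Proof. by rewrite adjacent_grid /grid_adj !grid_point_div !grid_point_mod. Qed.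

(** Positivity of [n] makes the exits [(n, 0)] and [(n, n)] distinct; the rest checks the hypotheses
    of [wins_reduction] on coordinates. *)
Lemma wins_grid s : 0 < n ->
  wins X E s <-> wins [set exit1; exit2] grid_edges (old_vertex s).
Proof.
move=> n_gt0.
have ltn (v : 'I_n) : (v < n) = true by rewrite ltn_ord.
have neqn (v : 'I_n) : (v == n :> nat) = false by rewrite ltn_eqF.
have neqn' (v : 'I_n) : (n == v :> nat) = false by rewrite eq_sym neqn.
have nn0 : (n == 0) = false by apply: gtn_eqF.
have n0n : (0 == n) = false by apply: ltn_eqF.
have val_max : (ord_max : 'I_n.+1) = n :> nat by [].
have val_0 : (ord0 : 'I_n.+1) = 0 :> nat by [].
have simp := (lift_max, val_max, val_0, ltn, neqn, neqn', nn0, n0n, ltnn, eqxx, n_gt0,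
  nat_exitE, nat_adjE, andbT, andbF, orbF, orbT).
apply: (@wins_reduction _ _ E X grid_edges old_vertex mid_vertex exit1 exit2 grid_label).
- move=> u; apply/setP=> v; rewrite !inE !grid_point_div !grid_point_mod.
  by rewrite !simp.
- move=> u w; apply/setP=> v; rewrite !inE !grid_point_div !grid_point_mod.
  by rewrite !simp.
- by apply/setP=> v; rewrite !inE !grid_point_div /= ltnn.
- by apply/setP=> v; rewrite !inE !grid_point_div /= ltnn.
- by apply/eqP=> /(congr1 val) /= /eqP; rewrite eqn_add2l n0n.
- move=> u q uX; have [c [d ->]] := grid_pointK q.
  rewrite adjacent_grid_point /linked /arrow !simp (negPf uX) !simp.
  (* Each coordinate of the neighbour is either [n] or an old vertex, which gives four cases. *)
  case: (unliftP ord_max c) => [c'|] ->; case: (unliftP ord_max d) => [d'|] ->;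
    rewrite !simp //=.
    case: (eqVneq (u : nat)) => //= /val_inj -> /andP[_ dX].
    by right; exists d'.
  by case/orP=> /andP[_ cX]; left; exists c'.
- move=> u x q uX xX; have [c [d ->]] := grid_pointK q.
  rewrite adjacent_grid_point /linked /arrow !simp.
  case: (unliftP ord_max c) => [c'|] ->; case: (unliftP ord_max d) => [d'|] ->;
    rewrite !simp //=.
  + by case: (eqVneq (c' : nat)) => //= /val_inj -> _; apply: Or31.
  + case: eqVneq => // d0 _; apply: Or32; congr (grid_point _ _).
    by apply: ord_inj; rewrite !simp.
  + by move=> _; apply: Or33.
- move=> u w uX; rewrite /gadget; have [wX|wX] := boolP (w \in X); last first.
    rewrite sub1set -[_ \in grid_edges]/(adjacent _ _ _) adjacent_grid_point.
    rewrite /linked /arrow !simp /= (negPf uX) (negPf wX) !simp.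
    by rewrite /adjacent [in X in _ || X]setUC orbb.
  rewrite !subUset !sub1set -![_ \in grid_edges]/(adjacent _ _ _) !adjacent_grid_point.
  by rewrite /linked /arrow !simp ?simp wX ?simp.
- move=> x xX; rewrite adjacent_grid_point /linked /arrow !simp xX.
  by rewrite /= ?simp.
Qed.

End GridInstance.

Definition reduction (I : instance) : instance :=
  @Instance (grid_size (num_vertices I)) (grid_edges (edges I) (exits I))
    (old_vertex (start I)) [set exit1 _; exit2 _]
    (grid_edges_simple (exits I) (edges_simple I)).

Lemma num_vertices_gt0 (I : instance) : 0 < num_vertices I.
Proof. exact: leq_ltn_trans (leq0n _) (ltn_ord (start I)). Qed.

Lemma reduction_correct (I : instance) :
  fugitive_has_winning_strategy I <-> fugitive_has_winning_strategy (reduction I).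
Proof.
apply: iff_trans (winning_strategyP _ _ _) _.
apply: iff_trans (iff_sym (winning_strategyP _ _ _)).
exact: wins_grid (num_vertices_gt0 I).
Qed.

Lemma reduction_exits (I : instance) :
  exists t1 t2 : 'I_(num_vertices (reduction I)),
    t1 != t2 /\ exits (reduction I) = [set t1; t2].
Proof.
exists (exit1 _), (exit2 _); split=> //.
apply/eqP=> /(congr1 val) /= /eqP.
by rewrite eqn_add2l eq_sym gtn_eqF // num_vertices_gt0.
Qed.

(** * A structured language compiled to the machine *)

Inductive expr :=
  | Var of nat
  | Num of nat
  | Plus of expr & expr
  | Minus of expr & expr
  | Cell of expr.

Inductive cmd :=
  | Assign of nat & expr
  | Put of expr & expr
  | ReadTo of nat
  | Output of expr
  | Seq of cmd & cmd
  | DoWhile of cmd & expr.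

Record state := State {
  vars : seq nat;
  cells : seq nat;
  input : seq bool;
  output : seq bool
}.

(* Registers below num_vars hold the variables, those from num_vars to heap are
   a stack for evaluating expressions, and those from heap on hold the cells. *)
Definition num_vars := 16.
Definition heap := 64.

(* A sufficiently large bound on the running time of a command without loops. *)
Definition unit_cost := 1000.

Fixpoint eval (s : state) (e : expr) : nat :=
  match e with
  | Var r => nth 0 (vars s) r
  | Num k => k
  | Plus e1 e2 => eval s e1 + eval s e2
  | Minus e1 e2 => eval s e1 - eval s e2
  | Cell e1 => nth 0 (cells s) (eval s e1)
  end.

(** The value ends up in register [d], and registers above [d] are scratch space. A register is
    copied by adding it to zero. *)
Fixpoint code_expr (d : nat) (e : expr) : seq instr :=
  match e with
  | Var r => [:: Const d 0; Add d d r]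
  | Num k => [:: Const d k]
  | Plus e1 e2 => code_expr d e1 ++ code_expr d.+1 e2 ++ [:: Add d d d.+1]
  | Minus e1 e2 => code_expr d e1 ++ code_expr d.+1 e2 ++ [:: Defs.Sub d d d.+1]
  | Cell e1 => code_expr d e1 ++ [:: Const d.+1 heap; Add d d.+1 d; Fetch d d]
  end.

(** Jump targets are absolute, so the code depends on its address [l]. *)
Fixpoint code (l : nat) (k : cmd) : seq instr :=
  match k with
  | Assign r e => code_expr num_vars e ++ [:: Const num_vars.+1 0; Add r num_vars num_vars.+1]
  | Put e1 e2 => code_expr num_vars (Plus (Num heap) e1) ++ code_expr num_vars.+1 e2
                   ++ [:: Store num_vars num_vars.+1]
  | ReadTo r => [:: Read r]
  | Output e => code_expr num_vars e ++ [:: Print num_vars]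
  | Seq k1 k2 => let c1 := code l k1 in c1 ++ code (l + size c1) k2
  | DoWhile k1 e => code l k1 ++ code_expr num_vars e ++ [:: Jpos num_vars l]
  end.

Fixpoint fits (d : nat) (e : expr) : bool :=
  match e with
  | Var r => (r < num_vars) && (d < heap)
  | Num _ => d < heap
  | Plus e1 e2 | Minus e1 e2 => fits d e1 && fits d.+1 e2
  | Cell e1 => fits d e1 && (d.+1 < heap)
  end.

(** The slack of 2 covers the instructions that follow the expression: two in an assignment, one in
    an output or a loop test. *)
Definition small (e : expr) : bool :=
  fits num_vars e && (size (code_expr num_vars e) + 2 <= unit_cost).

Definition represents (s : state) (m : nat -> nat) : Prop :=
  (forall j, j < num_vars -> m j = nth 0 (vars s) j) /\
  (forall j, m (heap + j) = nth 0 (cells s) j).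

(** * Correctness of the compiled code *)

Definition straight (a : instr) : bool := if a is Jpos _ _ then false else true.

Definition exec_all (C : seq instr) (c : config) : config :=
  foldl (fun c a => exec a c) c C.

Lemma exec_all_cat C1 C2 c : exec_all (C1 ++ C2) c = exec_all C2 (exec_all C1 c).
Proof. exact: foldl_cat. Qed.

Lemma step_at P pre a post c :
  P = pre ++ a :: post -> pc c = size pre -> step P c = exec a c.
Proof.
move=> -> pc_c; rewrite /step pc_c.
by elim: pre {pc_c} => //=.
Qed.

Lemma iter_straight P pre C post c :
    P = pre ++ C ++ post -> all straight C -> pc c = size pre ->
  iter (size C) (step P) c = exec_all C c.
Proof.
elim: C pre c => //= a C IHC pre c def_P /andP[Sa SC] pc_c.
rewrite -iterS iterSr (step_at def_P pc_c); apply: (IHC (rcons pre a)) => //.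
  by rewrite cat_rcons.
rewrite size_rcons -pc_c.
by case: a Sa {def_P} c {pc_c} => //= [i x|i j k|i j k|i j|i j|i|i] _ [].
Qed.

Lemma straight_expr d e : all straight (code_expr d e).
Proof.
elim: e d => //= [e1 IH1 e2 IH2|e1 IH1 e2 IH2|e1 IH1] d.
- by rewrite !all_cat IH1 IH2.
- by rewrite !all_cat IH1 IH2.
- by rewrite all_cat IH1.
Qed.

Lemma represents_frame s m m' :
  (forall j, (j < num_vars) || (heap <= j) -> m' j = m j) ->
  represents s m -> represents s m'.
Proof.
move=> eq_m [Hv Hc]; split=> [j lt_j|j]; first by rewrite eq_m ?lt_j ?Hv.
by rewrite eq_m ?Hc // leq_addr orbT.
Qed.

(** The frame condition drives the induction: a first operand held in [d] survives the evaluation of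
    the second one from [d.+1] on, and variables and cells are untouched. *)
Lemma exec_expr d e l m w o s :
    num_vars <= d -> fits d e -> represents s m ->
  exists m', [/\ exec_all (code_expr d e) (Config l m w o)
                   = Config (l + size (code_expr d e)) m' w o,
                 m' d = eval s e &
                 forall j, (j < d) || (heap <= j) -> m' j = m j].
Proof.
have frame d' m1 m2 : num_vars <= d' ->
    (forall j, (j < d') || (heap <= j) -> m2 j = m1 j) ->
    represents s m1 -> represents s m2.
  move=> le_d eq_m; apply: represents_frame => j lt_j; apply: eq_m; lia.
have fits_lt e' d' : fits d' e' -> d' < heap.
  elim: e' d' => /= [r|k|e1 IH1 e2 _|e1 IH1 e2 _|e1 IH1] d' // /andP[] //.
  - by move=> /IH1.
  - by move=> /IH1.
  - by move=> /IH1.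
elim: e d l m => /= [r|k|e1 IH1 e2 IH2|e1 IH1 e2 IH2|e1 IH1] d l m le_d fit_e rep.
- have [/andP[lt_r lt_d] [Hv _]] := (fit_e, rep); eexists; split.
  + by rewrite addn2 /exec_all /=.
  + by rewrite /upd eqxx (_ : (r == d) = false) ?Hv //; lia.
  + by move=> j lt_j; rewrite /upd (_ : (j == d) = false) //; lia.
- eexists; split.
  + by rewrite addn1 /exec_all /=.
  + by rewrite /upd eqxx.
  + by move=> j lt_j; rewrite /upd (_ : (j == d) = false) //; lia.
- have /andP[fit1 fit2] := fit_e.
  have [m1 [run1 val1 eq1]] := IH1 d l m le_d fit1 rep.
  have [|m2 [run2 val2 eq2]] :=
    IH2 d.+1 (l + size (code_expr d e1)) m1 _ fit2 (frame _ _ _ le_d eq1 rep).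
    exact: leqW.
  eexists; split.
  + by rewrite !exec_all_cat run1 run2 /exec_all /= !size_cat /= addn1 !addnA addnS.
  + by rewrite /upd eqxx val2 eq2 ?ltnSn // val1.
  + move=> j lt_j; rewrite /upd; have := fits_lt _ _ fit1.
    by case: eqVneq => [?|_ _]; [lia | rewrite eq2 ?eq1 //; lia].
- have /andP[fit1 fit2] := fit_e.
  have [m1 [run1 val1 eq1]] := IH1 d l m le_d fit1 rep.
  have [|m2 [run2 val2 eq2]] :=
    IH2 d.+1 (l + size (code_expr d e1)) m1 _ fit2 (frame _ _ _ le_d eq1 rep).
    exact: leqW.
  eexists; split.
  + by rewrite !exec_all_cat run1 run2 /exec_all /= !size_cat /= addn1 !addnA addnS.
  + by rewrite /upd eqxx val2 eq2 ?ltnSn // val1.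
  + move=> j lt_j; rewrite /upd; have := fits_lt _ _ fit1.
    by case: eqVneq => [?|_ _]; [lia | rewrite eq2 ?eq1 //; lia].
- have /andP[fit1 lt_d] := fit_e.
  have [m1 [run1 val1 eq1]] := IH1 d l m le_d fit1 rep.
  have [_ Hc] := frame _ _ _ le_d eq1 rep.
  eexists; split.
  + by rewrite exec_all_cat run1 /exec_all /= size_cat /= !addnS addn0.
  + rewrite /upd !eqxx (_ : (d == d.+1) = false) ?val1; last lia.
    have -> : (heap + eval s e1 == d) = false by lia.
    by have -> : (heap + eval s e1 == d.+1) = false by lia.
  + move=> j lt_j; rewrite /upd.
    have -> : (j == d) = false by lia.
    have -> : (j == d.+1) = false by lia.
    exact: eq1.
Qed.

(** A timed Hoare triple. Quantifying over the surrounding program and over all memories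
    representing [s] makes it composable. *)
Definition runs (k : cmd) (s s' : state) (T : nat) : Prop :=
  forall P pre post m, P = pre ++ code (size pre) k ++ post -> represents s m ->
  exists t m', [/\ t <= T, represents s' m' &
    iter t (step P) (Config (size pre) m (input s) (output s)) =
    Config (size pre + size (code (size pre) k)) m' (input s') (output s')].

Lemma runs_weaken k s s' T T' : T <= T' -> runs k s s' T -> runs k s s' T'.
Proof.
move=> leT run P pre post m def_P rep.
have [t [m' [le_t rep' eq_t]]] := run P pre post m def_P rep.
by exists t, m'; split=> //; apply: leq_trans leT.
Qed.

Lemma runs_straight k C s s' :
    (forall l, code l k = C) -> all straight C -> size C <= unit_cost ->
    (forall l m, represents s m -> exists2 m', represents s' m' &
       exec_all C (Config l m (input s) (output s)) =
       Config (l + size C) m' (input s') (output s')) ->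
  runs k s s' unit_cost.
Proof.
move=> codeC SC leC Hexec P pre post m; rewrite codeC => def_P rep.
have [m' rep' eq_m'] := Hexec (size pre) m rep.
exists (size C), m'; split=> //.
by rewrite (iter_straight def_P).
Qed.

Definition set_var (s : state) (r x : nat) : state :=
  State (set_nth 0 (vars s) r x) (cells s) (input s) (output s).

Lemma represents_set_var s m m' r x : r < num_vars ->
    (forall j, (j < num_vars) || (heap <= j) -> j != r -> m' j = m j) ->
    m' r = x -> represents s m -> represents (set_var s r x) m'.
Proof.
move=> lt_r eq_m m'r [Hv Hc]; split=> [j lt_j|j] /=.
  rewrite nth_set_nth /=; case: eqVneq => [->//|ne].
  by rewrite eq_m ?lt_j ?Hv.
rewrite eq_m ?Hc ?leq_addr ?orbT //.
by move: lt_r; rewrite /num_vars /heap; lia.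
Qed.

Lemma runs_assign r e s : r < num_vars -> small e ->
  runs (Assign r e) s (set_var s r (eval s e)) unit_cost.
Proof.
move=> lt_r /andP[fit_e sm_e]; apply: runs_straight => //=.
- by rewrite all_cat straight_expr.
- by rewrite size_cat.
move=> l m rep.
have [m' [run_e val_e eq_e]] := exec_expr l (input s) (output s) (leqnn _) fit_e rep.
eexists; last by rewrite exec_all_cat run_e /exec_all /= size_cat /= !addnS addn0.
apply: (represents_set_var _ _ _ rep) => // [j lt_j ne_j|].
  rewrite /upd (negPf ne_j) eq_e // (_ : (j == _) = false) //.
  by move: lt_j; rewrite /num_vars /heap; lia.
by rewrite /upd !eqxx val_e (_ : (num_vars == num_vars.+1) = false) // addn0.
Qed.

Lemma runs_read r s : r < num_vars ->
  runs (ReadTo r) s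
    (State (set_nth 0 (vars s) r (read_val (input s))) (cells s)
       (behead (input s)) (output s)) unit_cost.
Proof.
move=> lt_r; apply: (runs_straight (C := [:: Read r])) => //= l m rep.
eexists; last by rewrite /exec_all /= addn1.
apply: (represents_set_var (s := s) _ _ _ rep) => // [j _ ne_j|].
  by rewrite /upd (negPf ne_j).
by rewrite /upd eqxx.
Qed.

Lemma runs_output e s : small e ->
  runs (Output e) s
    (State (vars s) (cells s) (input s) (output s ++ [:: 0 < eval s e])) unit_cost.
Proof.
move=> /andP[fit_e sm_e]; apply: runs_straight => //=.
- by rewrite all_cat straight_expr.
- by rewrite size_cat /=; apply: leq_trans sm_e; rewrite leq_add2l.
move=> l m rep.
have [m' [run_e val_e eq_e]] := exec_expr l (input s) (output s) (leqnn _) fit_e rep.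
exists m'; first exact: represents_frame rep.
by rewrite exec_all_cat run_e /exec_all /= size_cat /= val_e cats1 addn1 addnS.
Qed.

Lemma runs_put e1 e2 s :
    fits num_vars.+1 e1 -> fits num_vars.+1 e2 ->
    size (code_expr num_vars (Plus (Num heap) e1)) + size (code_expr num_vars.+1 e2) + 1
      <= unit_cost ->
  runs (Put e1 e2) s
    (State (vars s) (set_nth 0 (cells s) (eval s e1) (eval s e2)) (input s) (output s))
    unit_cost.
Proof.
move=> fit1 fit2; set C1 := code_expr _ _; set C2 := code_expr _ _ => le_sz.
apply: (runs_straight (C := C1 ++ C2 ++ [:: Store num_vars num_vars.+1])) => //.
- by rewrite (all_cat _ C1) (all_cat _ C2) !straight_expr.
- by rewrite (size_cat C1) (size_cat C2) addnA.
move=> l m rep.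
have fitP : fits num_vars (Plus (Num heap) e1) by rewrite /= fit1.
have [m1 [run1 val1 eq1]] := exec_expr l (input s) (output s) (leqnn _) fitP rep.
have rep1 := represents_frame eq1 rep.
have [m2 [run2 val2 eq2]] :=
  exec_expr (l + size C1) (input s) (output s) (leqnSn _) fit2 rep1.
eexists; last first.
  rewrite -/C1 in run1; rewrite -/C2 in run2; clearbody C1 C2.
  by rewrite !exec_all_cat run1 run2 /exec_all /= !size_cat /= addn1 !addnS !addnA.
have [Hv Hc] := rep1; split=> [j lt_j|j] /=.
  rewrite /upd eq2 ?ltnSn // val1 /= (_ : (j == _) = false) ?eq2 ?Hv //.
    by rewrite ltnS (ltnW lt_j).
  by move: lt_j; rewrite /num_vars /heap; lia.
rewrite /upd [m2 num_vars]eq2 ?ltnSn // val1 /= val2 nth_set_nth /= eqn_add2l.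
by case: eqVneq => // _; rewrite eq2 ?Hc // leq_addr orbT.
Qed.

Lemma runs_seq k1 k2 s s1 s2 T1 T2 :
  runs k1 s s1 T1 -> runs k2 s1 s2 T2 -> runs (Seq k1 k2) s s2 (T1 + T2).
Proof.
move=> run1 run2 P pre post m /=; set C1 := code _ k1; set C2 := code _ k2 => def_P rep.
have [|t1 [m1 [le1 rep1 eq1]]] := run1 P pre (C2 ++ post) m _ rep.
  by rewrite def_P -!catA.
have [|t2 [m2 [le2 rep2 eq2]]] := run2 P (pre ++ C1) post m1 _ rep1.
  by rewrite def_P size_cat -!catA.
exists (t2 + t1), m2; split=> //; first by rewrite addnC leq_add.
by rewrite iterD eq1; move: eq2; rewrite !size_cat -/C1 -/C2 -addnA.
Qed.

Lemma exec_test e s P pre post m : small e ->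
    P = pre ++ code_expr num_vars e ++ post -> represents s m ->
  exists m', [/\ represents s m', m' num_vars = eval s e &
    iter (size (code_expr num_vars e)) (step P) (Config (size pre) m (input s) (output s))
    = Config (size pre + size (code_expr num_vars e)) m' (input s) (output s)].
Proof.
move=> /andP[fit_e _] def_P rep.
have [m' [run_e val_e eq_e]] := exec_expr (size pre) (input s) (output s) (leqnn _) fit_e rep.
exists m'; split=> //; first exact: represents_frame rep.
by rewrite (iter_straight def_P) ?straight_expr.
Qed.

Lemma runs_loop_last k e s s1 T : small e -> eval s1 e = 0 ->
  runs k s s1 T -> runs (DoWhile k e) s s1 (T + unit_cost).
Proof.
move=> sm_e e0 run P pre post m /=; set C := code _ k; set Ce := code_expr _ e => def_P rep.
have [|t1 [m1 [le1 rep1 eq1]]] := run P pre (Ce ++ Jpos num_vars (size pre) :: post) m _ rep.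
  by rewrite def_P -!catA.
have [|m2 [rep2 val2 eq2]] := exec_test (P := P) (pre := pre ++ C)
  (post := Jpos num_vars (size pre) :: post) sm_e _ rep1.
  by rewrite def_P -!catA.
exists (1 + (size Ce + t1)), m2; split=> //.
  have /andP[_] := sm_e; rewrite -/Ce; lia.
rewrite iterD iterD eq1 -size_cat eq2 -/Ce -size_cat /=.
rewrite (@step_at _ ((pre ++ C) ++ Ce) (Jpos num_vars (size pre)) post) //.
  by rewrite /= val2 e0 /= !size_cat /= addn1 !addnS !addnA.
by rewrite def_P -!catA.
Qed.

Lemma runs_loop_next k e s s1 s2 T1 T2 : small e -> 0 < eval s1 e ->
    runs k s s1 T1 -> runs (DoWhile k e) s1 s2 T2 ->
  runs (DoWhile k e) s s2 (T1 + unit_cost + T2).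
Proof.
move=> sm_e e0 run run' P pre post m def_P rep; have := def_P.
rewrite /=; set C := code _ k; set Ce := code_expr _ e => def_P'.
have [|t1 [m1 [le1 rep1 eq1]]] := run P pre (Ce ++ Jpos num_vars (size pre) :: post) m _ rep.
  by rewrite def_P' -!catA.
have [|m2 [rep2 val2 eq2]] := exec_test (P := P) (pre := pre ++ C)
  (post := Jpos num_vars (size pre) :: post) sm_e _ rep1.
  by rewrite def_P' -!catA.
have [t3 [m3 [le3 rep3 eq3]]] := run' P pre post m2 def_P rep2.
exists (t3 + (1 + (size Ce + t1))), m3; split=> //.
  have /andP[_] := sm_e; rewrite -/Ce; lia.
rewrite iterD iterD iterD eq1 -size_cat eq2 -/Ce -size_cat /=.
rewrite (@step_at _ ((pre ++ C) ++ Ce) (Jpos num_vars (size pre)) post) //.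
  by rewrite /= val2 e0 eq3.
by rewrite def_P' -!catA.
Qed.

(** State [f i] precedes pass [i]; the induction peels off the first pass and shifts [f]. The body
    runs before the test, so [N] is positive. *)
Lemma runs_iter k e (f : nat -> state) N T : small e -> 0 < N ->
    (forall i, i < N -> runs k (f i) (f i.+1) T) ->
    (forall i, i.+1 < N -> 0 < eval (f i.+1) e) -> eval (f N) e = 0 ->
  runs (DoWhile k e) (f 0) (f N) (N * (T + unit_cost)).
Proof.
move=> sm_e; case: N => // N _; elim: N f => [|N IHN] f run pos e0.
  by rewrite mul1n; apply: runs_loop_last => //; apply: run.
rewrite mulSn; apply: (@runs_loop_next _ _ _ (f 1)) => //; [exact: pos | exact: run |].
by apply: (IHN (f \o succn)) => //= i lt_i; [apply: run | apply: pos].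
Qed.

(** * Boolean tests as arithmetic expressions *)

Inductive test :=
  | Lt of expr & expr
  | Eq of expr & expr
  | Bit of expr
  | Neg of test
  | And of test & test
  | Or of test & test.

Fixpoint holds (s : state) (b : test) : bool :=
  match b with
  | Lt e1 e2 => eval s e1 < eval s e2
  | Eq e1 e2 => eval s e1 == eval s e2
  | Bit e => 0 < eval s (Cell e)
  | Neg b1 => ~~ holds s b1
  | And b1 b2 => holds s b1 && holds s b2
  | Or b1 b2 => holds s b1 || holds s b2
  end.

Definition is_zero (e : expr) : expr := Minus (Num 1) e.

(** Subtraction is truncated: a double [is_zero] maps positive numbers to 1, and the two opposite
    differences are both 0 exactly for equal numbers. *)
Fixpoint expr_of_test (b : test) : expr :=
  match b with
  | Lt e1 e2 => is_zero (is_zero (Minus e2 e1))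
  | Eq e1 e2 => is_zero (Plus (Minus e1 e2) (Minus e2 e1))
  | Bit e => is_zero (is_zero (Cell e))
  | Neg b1 => is_zero (expr_of_test b1)
  | And b1 b2 => Minus (Plus (expr_of_test b1) (expr_of_test b2)) (Num 1)
  | Or b1 b2 => is_zero (is_zero (Plus (expr_of_test b1) (expr_of_test b2)))
  end.

Lemma eval_test s b : eval s (expr_of_test b) = holds s b.
Proof.
elim: b => /= [e1 e2|e1 e2|e|b1 ->|b1 -> b2 ->|b1 -> b2 ->].
- by case: ltnP; lia.
- by case: eqVneq; lia.
- by case: (nth _ _ _).
- by case: (holds s b1).
- by case: (holds s b1); case: (holds s b2).
- by case: (holds s b1); case: (holds s b2).
Qed.

Lemma runs_output_test b s : small (expr_of_test b) ->
  runs (Output (expr_of_test b)) s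
    (State (vars s) (cells s) (input s) (output s ++ [:: holds s b])) unit_cost.
Proof.
by move=> sm_b; have := runs_output (s := s) sm_b; rewrite eval_test lt0b.
Qed.

(* Variable 0 holds the number n of vertices of the input. *)
Definition For (r : nat) (k : cmd) : cmd :=
  Seq (DoWhile (Seq k (Assign r (Plus (Var r) (Num 1))))
         (Minus (Plus (Var 0) (Num 1)) (Var r)))
      (Assign r (Num 0)).

(** The variables are [f i] before and [g i] after the body of pass [i], so the body may also
    advance other counters. There are [n.+1] passes, one for each value of a grid coordinate. *)
Lemma runs_for r k n (f g : nat -> seq nat) F ar w o T :
    r < num_vars ->
    (forall i o', i <= n -> runs k (State (f i) ar w o') (State (g i) ar w (o' ++ F i)) T) ->
    (forall i, set_nth 0 (g i) r (nth 0 (g i) r + 1) = f i.+1) ->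
    (forall i, nth 0 (f i) r = i) -> (forall i, nth 0 (f i) 0 = n) ->
  runs (For r k) (State (f 0) ar w o)
    (State (set_nth 0 (f n.+1) r 0) ar w (o ++ flatten [seq F i | i <- iota 0 n.+1]))
    (n.+1 * (T + 2 * unit_cost) + unit_cost).
Proof.
move=> lt_r body next fr f0.
pose h i := State (f i) ar w (o ++ flatten [seq F j | j <- iota 0 i]).
have small1 e : size (code_expr num_vars e) <= 10 -> fits num_vars e -> small e.
  rewrite /small => le10 ->; rewrite andTb.
  by apply: (@leq_trans 12) => //; rewrite -[12]/(10 + 2) leq_add2r.
have small_r : small (Plus (Var r) (Num 1)) by apply: small1 => //=; rewrite lt_r.
have small_t : small (Minus (Plus (Var 0) (Num 1)) (Var r)).
  by apply: small1 => //=; rewrite lt_r.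
apply: (@runs_seq _ _ _ (h n.+1)); last exact: (runs_assign (s := h n.+1) lt_r).
(* In each pass one unit pays for the increment and one for the test. *)
rewrite mul2n -addnn addnA.
have -> : State (f 0) ar w o = h 0 by rewrite /h /= cats0.
apply: runs_iter => // [i lt_i|i lt_i|]; last 2 first.
- by rewrite /= fr f0; lia.
- by rewrite /= fr f0; lia.
apply: runs_seq; first exact: body.
have := runs_assign
  (s := State (g i) ar w ((o ++ flatten [seq F j | j <- iota 0 i]) ++ F i)) lt_r small_r.
rewrite /set_var /= next /h.
by rewrite -[iota 0 i.+1]/(iota 0 (1 + i)) addnC iotaD map_cat flatten_cat /= cats0 catA.
Qed.

(** * The program that reads a graph and prints the grid instance *)

Definition frame n a b c d an cn t p : seq nat := [:: n; a; b; c; d; an; cn; t; p].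

Definition read_unary : cmd :=
  DoWhile (Seq (ReadTo 7) (Assign 0 (Plus (Var 0) (Var 7)))) (Var 7).

Lemma runs_read_unary i t n w :
  runs read_unary
    (State (frame i 0 0 0 0 0 0 t 0) [::] (nseq n true ++ false :: w) [::])
    (State (frame (i + n) 0 0 0 0 0 0 0 0) [::] w [::])
    (n.+1 * (3 * unit_cost)).
Proof.
have body j t' b w' : runs (Seq (ReadTo 7) (Assign 0 (Plus (Var 0) (Var 7))))
    (State (frame j 0 0 0 0 0 0 t' 0) [::] (b :: w') [::])
    (State (frame (j + b) 0 0 0 0 0 0 b 0) [::] w' [::]) (unit_cost + unit_cost).
  by apply: runs_seq; [apply: runs_read | apply: runs_assign].
elim: n i t => [|n IHn] i t.
  rewrite addn0 mul1n mulSn mul2n -addnn addnC.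
  by apply: runs_loop_last => //; have := body i t false w; rewrite addn0.
rewrite -addSnnS -(addn1 i) mulSn.
apply: (runs_weaken (T := unit_cost + unit_cost + unit_cost + n.+1 * (3 * unit_cost))).
  by rewrite leq_add2r !mulSn mul0n addn0 addnA.
by apply: runs_loop_next (body i t true _) (IHn _ _).
Qed.

Lemma set_nth_size (T : Type) (x0 x : T) (q : seq T) : set_nth x0 q (size q) x = rcons q x.
Proof. by elim: q => //= y q ->. Qed.

(** The end marker 2 stops the loop, after being stored as a last cell. Variable 8 is the next free
    cell. *)
Definition read_rest : cmd :=
  DoWhile (Seq (ReadTo 7) (Seq (Put (Var 8) (Var 7)) (Assign 8 (Plus (Var 8) (Num 1)))))
    (Minus (Num 2) (Var 7)).

Lemma runs_read_rest n t ar w :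
  runs read_rest
    (State (frame n 0 0 0 0 0 0 t (size ar)) ar w [::])
    (State (frame n 0 0 0 0 0 0 2 (size ar + (size w).+1))
       (rcons (ar ++ map nat_of_bool w) 2) [::] [::])
    ((size w).+1 * (4 * unit_cost)).
Proof.
have body t' ar' w' : runs
    (Seq (ReadTo 7) (Seq (Put (Var 8) (Var 7)) (Assign 8 (Plus (Var 8) (Num 1)))))
    (State (frame n 0 0 0 0 0 0 t' (size ar')) ar' w' [::])
    (State (frame n 0 0 0 0 0 0 (read_val w') (size ar').+1)
       (rcons ar' (read_val w')) (behead w') [::]) (unit_cost + (unit_cost + unit_cost)).
  apply: runs_seq; first exact: runs_read.
  rewrite -(set_nth_size 0); apply: runs_seq; first exact: runs_put.
  by rewrite -(addn1 (size ar')); apply: runs_assign.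
elim: w t ar => [|b w IHw] t ar.
  rewrite cats0 addn1 mul1n -[4]/(3 + 1) mulnDl mul1n !mulSn mul0n addn0.
  exact: runs_loop_last (body t ar [::]).
rewrite mulSn.
apply: (runs_weaken (T := unit_cost + (unit_cost + unit_cost) + unit_cost
                          + (size w).+1 * (4 * unit_cost))).
  by rewrite leq_add2r; lia.
apply: runs_loop_next (body t ar (b :: w)) _ => //; first by case: b.
by have := IHw b (rcons ar b); rewrite size_rcons addSnnS cat_rcons.
Qed.

(** Past the unary prefix, the input gives [n] start bits, [n] exit bits and the adjacency rows.
    Variable [rn] holds [n] times the row index, so addresses need only additions. *)
Definition exit_test (r : nat) : test := Bit (Plus (Var 0) (Var r)).
Definition adj_test (rn r : nat) : test :=
  Bit (Plus (Plus (Plus (Var 0) (Var 0)) (Var rn)) (Var r)).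

Definition arrow_test (a b c d an : nat) : test :=
  let n := Var 0 in
  Or (And (Eq (Var b) n) (And (Eq (Var d) n) (And (Lt (Var a) n) (And (Lt (Var c) n)
       (And (adj_test an c) (And (Neg (exit_test a)) (Neg (exit_test c))))))))
 (Or (And (Eq (Var b) n) (And (Lt (Var d) n) (And (Eq (Var a) (Var c)) (And (Lt (Var a) n)
       (And (adj_test an d) (exit_test d))))))
     (And (Eq (Var c) n) (And (Or (Eq (Var d) (Num 0)) (Eq (Var d) n))
       (And (Lt (Var a) n) (Or (Lt (Var b) n) (exit_test a)))))).

Definition linked_test : test := Or (arrow_test 1 2 3 4 5) (arrow_test 3 4 1 2 6).

Definition cell_exit (ar : seq nat) (n i : nat) : bool := 0 < nth 0 ar (n + i).
Definition cell_adj (ar : seq nat) (n i j : nat) : bool :=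
  0 < nth 0 ar (n + n + i * n + j).

(** The test copies the shape of [linked] connective by connective, so both sides agree by
    computation. *)
Lemma holds_linked n a b c d ar w o :
  holds (State (frame n a b c d (a * n) (c * n) 0 0) ar w o) linked_test =
  linked n (cell_exit ar n) (cell_adj ar n) a b c d.
Proof. by []. Qed.

Definition print_matrix (b : test) : cmd := For 1 (For 2 (Output (expr_of_test b))).

Lemma runs_print_matrix b G n ar w o : small (expr_of_test b) ->
    (forall i j o', holds (State (frame n i j 0 0 0 0 0 0) ar w o') b = G i j) ->
  runs (print_matrix b) (State (frame n 0 0 0 0 0 0 0 0) ar w o)
    (State (frame n 0 0 0 0 0 0 0 0) ar w
       (o ++ flatten [seq flatten [seq [:: G i j] | j <- iota 0 n.+1] | i <- iota 0 n.+1]))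
    (n.+1 ^ 2 * (8 * unit_cost)).
Proof.
move=> sm_b hG.
apply: (@runs_weaken _ _ _
  (n.+1 * (n.+1 * (unit_cost + 2 * unit_cost) + unit_cost + 2 * unit_cost) + unit_cost)).
  by nia.
apply: (@runs_for 1 _ n (fun i => frame n i 0 0 0 0 0 0 0) (fun i => frame n i 0 0 0 0 0 0 0)
  (fun i => flatten [seq [:: G i j] | j <- iota 0 n.+1])) => // [i o' _|i]; last first.
  by rewrite /= addn1.
apply: (@runs_for 2 _ n (fun j => frame n i j 0 0 0 0 0 0) (fun j => frame n i j 0 0 0 0 0 0)
  (fun j => [:: G i j])) => // [j o2 _|j]; last by rewrite /= addn1.
rewrite -(hG i j o2).
exact: (runs_output_test (s := State (frame n i j 0 0 0 0 0 0) ar w o2)).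
Qed.

(* Variables 5 and 6 hold n times variables 1 and 3. *)
Definition print_edges : cmd :=
  For 1 (Seq (For 2 (Seq (For 3 (Seq (For 4 (Output (expr_of_test linked_test)))
                                     (Assign 6 (Plus (Var 6) (Var 0)))))
                         (Assign 6 (Num 0))))
             (Assign 5 (Plus (Var 5) (Var 0)))).

Lemma runs_print_edges n ar w o :
  runs print_edges (State (frame n 0 0 0 0 0 0 0 0) ar w o)
    (State (frame n 0 0 0 0 (n.+1 * n) 0 0 0) ar w
       (o ++ flatten [seq flatten [seq flatten [seq flatten
              [seq [:: linked n (cell_exit ar n) (cell_adj ar n) a b c d]
                 | d <- iota 0 n.+1] | c <- iota 0 n.+1]
                 | b <- iota 0 n.+1] | a <- iota 0 n.+1]))
    (n.+1 ^ 4 * (16 * unit_cost)).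
Proof.
set L := linked n _ _; set M := iota 0 n.+1; set K := unit_cost.
(* These are the costs of the one to four innermost loops, with the assignments after inner loops;
   [i] nested loops cost at most [4 * i * K] times [n.+1 ^ i]. *)
pose T1 := n.+1 * (K + 2 * K) + K; pose T2 := n.+1 * (T1 + K + 2 * K) + K.
pose T3 := n.+1 * (T2 + K + 2 * K) + K; pose T4 := n.+1 * (T3 + K + 2 * K) + K.
have [le1 le2 le3 le4] : [/\ T1 <= n.+1 * (4 * K), T2 <= n.+1 ^ 2 * (8 * K),
    T3 <= n.+1 ^ 3 * (12 * K) & T4 <= n.+1 ^ 4 * (16 * K)].
  have le1 : T1 <= n.+1 * (4 * K) by rewrite /T1; nia.
  have le2 : T2 <= n.+1 ^ 2 * (8 * K) by rewrite /T2; nia.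
  have le3 : T3 <= n.+1 ^ 3 * (12 * K) by rewrite /T3; nia.
  by split=> //; rewrite /T4; nia.
apply: (runs_weaken le4).
apply: (@runs_for 1 _ n (fun a => frame n a 0 0 0 (a * n) 0 0 0)
  (fun a => frame n a 0 0 0 (a * n + n) 0 0 0)
  (fun a => flatten [seq flatten [seq flatten [seq [:: L a b c d] | d <- M] | c <- M] | b <- M]))
  => // [a o1 _|a]; last by rewrite /= addn1 mulSnr.
apply: runs_seq; [apply: (@runs_for 2 _ n (fun b => frame n a b 0 0 (a * n) 0 0 0)
  (fun b => frame n a b 0 0 (a * n) 0 0 0)
  (fun b => flatten [seq flatten [seq [:: L a b c d] | d <- M] | c <- M]))
  => // [b o2 _|b]; last by rewrite /= addn1 | exact: runs_assign].
apply: runs_seq; [apply: (@runs_for 3 _ n (fun c => frame n a b c 0 (a * n) (c * n) 0 0)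
  (fun c => frame n a b c 0 (a * n) (c * n + n) 0 0)
  (fun c => flatten [seq [:: L a b c d] | d <- M]))
  => // [c o3 _|c]; last by rewrite /= addn1 mulSnr | exact: runs_assign].
apply: runs_seq; [apply: (@runs_for 4 _ n (fun d => frame n a b c d (a * n) (c * n) 0 0)
  (fun d => frame n a b c d (a * n) (c * n) 0 0) (fun d => [:: L a b c d]))
  => // [d o4 _|d]; last by rewrite /= addn1 | exact: runs_assign].
rewrite /L -(holds_linked n a b c d ar w o4).
exact: (runs_output_test (s := State (frame n a b c d (a * n) (c * n) 0 0) ar w o4)).
Qed.

Definition start_test : test :=
  And (Eq (Var 2) (Var 0)) (And (Lt (Var 1) (Var 0)) (Bit (Var 1))).
Definition exits_test : test :=
  And (Eq (Var 1) (Var 0)) (Or (Eq (Var 2) (Num 0)) (Eq (Var 2) (Var 0))).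

(** The all-true matrix is the new number of vertices in unary, and the single 0 after it is the
    separator. Variables 7 and 8 are cleared to restore the frame expected by the printing loops. *)
Definition reducer : cmd :=
  Seq read_unary (Seq read_rest (Seq (Assign 7 (Num 0)) (Seq (Assign 8 (Num 0))
 (Seq (print_matrix (Eq (Num 0) (Num 0))) (Seq (Output (Num 0))
 (Seq (print_matrix start_test) (Seq (print_matrix exits_test) print_edges))))))).

Definition flat_matrix (T : Type) (n : nat) (G : nat -> nat -> T) : seq T :=
  flatten [seq flatten [seq [:: G i j] | j <- iota 0 n.+1] | i <- iota 0 n.+1].

Lemma runs_reducer n w (ar := rcons (map nat_of_bool w) 2) :
  runs reducer (State (frame 0 0 0 0 0 0 0 0 0) [::] (nseq n true ++ false :: w) [::])
    (State (frame n 0 0 0 0 (n.+1 * n) 0 0 0) ar [::]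
      (((((flat_matrix n (fun _ _ => true)) ++ [:: false]) ++
      flat_matrix n (fun i j => [&& j == n, i < n & 0 < nth 0 ar i])) ++
      flat_matrix n (fun i j => (i == n) && ((j == 0) || (j == n)))) ++
      flatten [seq flatten [seq flatten [seq flatten
              [seq [:: linked n (cell_exit ar n) (cell_adj ar n) a b c d]
                 | d <- iota 0 n.+1] | c <- iota 0 n.+1]
                 | b <- iota 0 n.+1] | a <- iota 0 n.+1]))
   (n.+1 * (3 * unit_cost) + ((size w).+1 * (4 * unit_cost) + (unit_cost + (unit_cost +
   (n.+1 ^ 2 * (8 * unit_cost) + (unit_cost + (n.+1 ^ 2 * (8 * unit_cost) +
   (n.+1 ^ 2 * (8 * unit_cost) + n.+1 ^ 4 * (16 * unit_cost))))))))).
Proof.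
apply: runs_seq; first exact: runs_read_unary.
apply: runs_seq; first exact: (@runs_read_rest n 0 [::] w).
apply: runs_seq; first exact: runs_assign.
apply: runs_seq; first exact: runs_assign.
apply: runs_seq; first exact: (@runs_print_matrix _ (fun _ _ => true)).
apply: runs_seq; first exact: runs_output.
apply: runs_seq; first exact: (@runs_print_matrix _
  (fun i j => [&& j == n, i < n & 0 < nth 0 ar i])).
apply: runs_seq; first exact: (@runs_print_matrix _
  (fun i j => (i == n) && ((j == 0) || (j == n)))).
exact: runs_print_edges.
Qed.

(** * The machine computes the reduction *)

(** Row-major order turns two nested loops into one, matching the enumeration of ordinals in
    [encode]. *)
Lemma flatten_grid (T : Type) (H : nat -> nat -> seq T) p q :
  flatten [seq flatten [seq H i j | j <- iota 0 q] | i <- iota 0 p] =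
  flatten [seq H (k %/ q) (k %% q) | k <- iota 0 (p * q)].
Proof.
elim: p => // p IHp; rewrite -[in LHS]addn1 mulSnr !iotaD !map_cat !flatten_cat IHp.
congr (_ ++ _); rewrite /= cats0 add0n -[p * q in RHS]addn0 (iotaDl (p * q)) -map_comp.
congr flatten; apply: (eq_in_map _ _ _).1 => j; rewrite mem_iota => /= lt_j.
have q_gt0 : 0 < q by exact: leq_ltn_trans lt_j.
by rewrite divnMDl // divn_small // addn0 modnMDl modn_small.
Qed.

Lemma map_enum_ord (T : Type) N (G : 'I_N -> T) (H : nat -> T) :
  (forall i : 'I_N, G i = H i) -> [seq G i | i <- enum 'I_N] = [seq H k | k <- iota 0 N].
Proof. by move=> GH; rewrite -val_enum_ord -map_comp; apply: eq_map. Qed.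

Lemma flat_matrixE (T : Type) n (G : nat -> nat -> T) :
  flat_matrix n G = [seq G (k %/ n.+1) (k %% n.+1) | k <- iota 0 (grid_size n)].
Proof. by rewrite /flat_matrix flatten_grid flatten_map1. Qed.

Section Encoding.

Variable I : instance.
Let n := num_vertices I.
Let ex := nat_exit (exits I).
Let ad := nat_adj (edges I).

Definition graph_bits : seq bool :=
  [seq k == start I :> nat | k <- iota 0 n] ++ [seq ex k | k <- iota 0 n] ++
  [seq ad (k %/ n) (k %% n) | k <- iota 0 (n * n)].

Lemma encodeE : encode I = nseq n true ++ false :: graph_bits.
Proof.
rewrite /encode /graph_bits; congr (_ ++ _ :: _ ++ _ ++ _).
- exact: map_enum_ord.
- by apply: map_enum_ord => i; apply/esym/nat_exitE.
rewrite -[RHS]flatten_map1 -(flatten_grid (fun i j => [:: ad i j])); congr flatten.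
apply: map_enum_ord => i; rewrite flatten_map1; apply: map_enum_ord => j.
exact/esym/nat_adjE.
Qed.

Lemma size_graph_bits : size graph_bits = n + (n + n * n).
Proof. by rewrite !size_cat !size_map !size_iota. Qed.

Let ar := rcons (map nat_of_bool graph_bits) 2.

Lemma nth_bits k : k < size graph_bits -> (0 < nth 0 ar k) = nth false graph_bits k.
Proof. by move=> lt_k; rewrite nth_rcons size_map lt_k (nth_map false) // lt0b. Qed.

Lemma nth_start k : k < n -> (0 < nth 0 ar k) = (k == start I).
Proof.
move=> lt_k; rewrite nth_bits ?size_graph_bits; last lia.
by rewrite nth_cat size_map size_iota lt_k (nth_map 0) ?size_iota // nth_iota.
Qed.

Lemma nth_exit k : k < n -> cell_exit ar n k = ex k.
Proof.
move=> lt_k; rewrite /cell_exit nth_bits ?size_graph_bits; last lia.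
rewrite nth_cat size_map size_iota ltnNge leq_addr /= addKn.
by rewrite nth_cat size_map size_iota lt_k (nth_map 0) ?size_iota // nth_iota.
Qed.

Lemma nth_adj i j : i < n -> j < n -> cell_adj ar n i j = ad i j.
Proof.
move=> lt_i lt_j; have lt_ij : i * n + j < n * n by nia.
rewrite /cell_adj -!addnA nth_bits ?size_graph_bits; last lia.
rewrite nth_cat size_map size_iota ltnNge leq_addr /= addKn.
rewrite nth_cat size_map size_iota ltnNge leq_addr /= addKn.
rewrite (nth_map 0) ?size_iota // nth_iota // add0n.
by rewrite divnMDl ?divn_small ?addn0 ?modnMDl ?modn_small //; lia.
Qed.

Lemma encode_reduction :
  encode (reduction I) = (((flat_matrix n (fun _ _ => true) ++ [:: false]) ++
      flat_matrix n (fun i j => [&& j == n, i < n & 0 < nth 0 ar i])) ++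
      flat_matrix n (fun i j => (i == n) && ((j == 0) || (j == n)))) ++
      flatten [seq flatten [seq flatten [seq flatten
              [seq [:: linked n (cell_exit ar n) (cell_adj ar n) a b c d]
                 | d <- iota 0 n.+1] | c <- iota 0 n.+1]
                 | b <- iota 0 n.+1] | a <- iota 0 n.+1].
Proof.
have assoc (u v x y : seq bool) :
    (((u ++ [:: false]) ++ v) ++ x) ++ y = u ++ false :: v ++ x ++ y.
  by rewrite -!catA.
have map_true m N : [seq true | _ <- iota m N] = nseq N true.
  by elim: N m => //= N IHN m; rewrite IHN.
rewrite assoc /encode; congr (_ ++ _ :: _ ++ _ ++ _).
- by rewrite flat_matrixE map_true.
- rewrite flat_matrixE; apply: map_enum_ord => i; have [a [b ->]] := grid_pointK i.
  rewrite grid_point_div grid_point_mod; apply/eqP/and3P => [eq_ab|[/eqP bn an]].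
    have -> : a = lift ord_max (start I).
      by apply: ord_inj; rewrite -(grid_point_div a b) eq_ab grid_point_div.
    have -> : b = ord_max.
      by apply: ord_inj; rewrite -(grid_point_mod a b) eq_ab grid_point_mod.
    by rewrite lift_max nth_start ?ltn_ord.
  rewrite nth_start // => /eqP as_.
  by congr grid_point; apply: ord_inj; rewrite ?lift_max.
- rewrite flat_matrixE; apply: map_enum_ord => i; have [a [b ->]] := grid_pointK i.
  rewrite grid_point_div grid_point_mod !inE.
  apply/orP/andP => [[]|[/eqP an /orP[]] /eqP b0].
  + move/eqP=> eq_ab; rewrite -(grid_point_div a b) -(grid_point_mod a b) eq_ab.
    by rewrite grid_point_div grid_point_mod /= eqxx.
  + move/eqP=> eq_ab; rewrite -(grid_point_div a b) -(grid_point_mod a b) eq_ab.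
    by rewrite grid_point_div grid_point_mod /= eqxx orbT.
  + by left; apply/eqP; congr grid_point; apply: ord_inj.
  + by right; apply/eqP; congr grid_point; apply: ord_inj.
(* The loops over [(a, b)], then those over [(c, d)], collapse to loops over vertex numbers. *)
rewrite flatten_grid; congr flatten; apply: map_enum_ord => i.
rewrite flatten_grid flatten_map1; apply: map_enum_ord => j.
rewrite adjacent_grid; apply: eq_linked => *; apply/esym; [exact: nth_exit | exact: nth_adj].
Qed.

End Encoding.

Lemma iter_halted P c t : size P <= pc c -> iter t (step P) c = c.
Proof.
by move=> halt; elim: t => //= t ->; rewrite /step onth_default.
Qed.

(** The initial memory is zero everywhere, so it represents zero variables and no cells. The run
    ends just past the code, where the machine stays put for the spare time. *)
Lemma runs_outputs k vs w s' T t :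
    (forall j, nth 0 vs j = 0) -> T <= t ->
  runs k (State vs [::] w [::]) s' T -> outputs_within (code 0 k) t w (output s').
Proof.
move=> vs0 le_T run.
have [| |t' [m' [le_t' _ eq_t']]] := run (code 0 k) [::] [::] (fun _ => 0).
- by rewrite cats0.
- by split=> j /=; rewrite ?vs0 ?nth_nil.
by rewrite /outputs_within -(subnK (leq_trans le_t' le_T)) iterD eq_t' iter_halted.
Qed.

Lemma reduction_polytime : polytime encode encode reduction.
Proof.
(* Exponent 4 comes from the four nested printing loops. The coefficients in [runs_reducer] add up
   to 50 units, below the 60 allowed. *)
exists (code 0 reducer), (60 * unit_cost), 4 => I.
rewrite encode_reduction encodeE.
apply: (runs_outputs _ _ (@runs_reducer (num_vertices I) (graph_bits I))).
  by do 9?case=> //; apply: nth_nil.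
rewrite size_cat size_nseq /=; set n := num_vertices I; set z := size _.
set K := unit_cost.
have [le_n le_z] : n.+1 <= n + z.+1 /\ z.+1 <= n + z.+1 by split; lia.
move: (n + _) le_n le_z => L le_n le_z.
have leX i : n.+1 ^ i <= L ^ i by case: i => // i; rewrite leq_exp2r.
have L_gt0 : 0 < L by apply: leq_trans le_n.
have leL i : i <= 4 -> L ^ i <= L ^ 4 by move=> ?; rewrite leq_pexp2l.
have := (leq_trans (leX 2) (leL 2 isT), leX 4, leL 1 isT, leL 0 isT).
rewrite expn1 expn0; set L4 := L ^ 4; set N2 := n.+1 ^ 2; set N4 := n.+1 ^ 4.
move=> [[[le2 le4] leL1] le0].
have le_n4 : n.+1 <= L4 by exact: leq_trans leL1.
have le_z4 : z.+1 <= L4 by exact: leq_trans leL1.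
clearbody N2 N4 L4; move: (n.+1) (z.+1) le_n4 le_z4 => a b le_a le_b.
by rewrite -(mulnA 60) (mulnC K) ; clearbody K; nia.
Qed.

Theorem theorem9 :
  exists f : instance -> instance,
    polytime encode encode f /\
    forall I : instance,
      (exists t1 t2 : 'I_(num_vertices (f I)),
         t1 != t2 /\ exits (f I) = [set t1; t2]) /\
      (fugitive_has_winning_strategy I <->
       fugitive_has_winning_strategy (f I)).
Proof.
exists reduction; split; first exact: reduction_polytime.
by move=> I; split; [apply: reduction_exits | apply: reduction_correct].
Qed.
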